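(* SAP (as defined in the context) with a Pareto-conform psychological model and cost functions with Pareto dimension $k$ whose derivatives have Pareto dimension $\ell$ reduces to solving a multi-criteria shortest path problem with $k+\ell$ criteria on $G$ and scoring the result. That is, there are weight vectors $w(e)\in\mathbb{Q}^{k+\ell}$ for the edges of $G$ such that the set of $s$–$t$ paths whose total weight is not Pareto dominated by that of another $s$–$t$ path contains an optimal solution of SAP.
   Context: Setting (SAP). Let $G=(V,E)$ be a directed graph, $s,t\in V$, and $d>0$ a rational demand. Every edge $e$ has a cost function $\tau_e:\mathbb{Q}_{\ge 0}\to\mathbb{Q}_{>0}$ that is monotonically increasing and differentiable; all cost functions are considered only on $[0,d]$, and an inequality between functions means it holds for every $x\in[0,d]$. Paths are identified with their edge sets; for a set $A$ of edges, $\tau_A=\sum_{e\in A}\tau_e$ (zero if $A=\emptyset$) and $\tau'_A$ is its derivative. An original simple $s$–$t$ path $Q$ is fixed. An alternative is a simple $s$–$t$ path $P$. For $x\in[0,d]$ put $\mathcal{C}_P(x)=x\,\tau_{P\setminus Q}(x)+(d-x)\,\tau_{Q\setminus P}(d-x)+d\,\tau_{P\cap Q}(d)$. A psychological model assigns to every alternative $P$ a value $x_P\in[0,d]$, and $\mathcal{C}_P:=\mathcal{C}_P(x_P)$. SAP asks for an alternative minimizing $\mathcal{C}_P$. Dominance: $P_1\preceq P_2$ iff $\tau_{P_1}\le\tau_{P_2}$ and $\tau'_{P_1\cap Q}\le\tau'_{P_2\cap Q}$. The model is Pareto-conform if $P_1\preceq P_2$ implies $\mathcal{C}_{P_1}\le\mathcal{C}_{P_2}$.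 Standing assumption: no two different paths dominate each other mutually. Pareto dimension: a class $\mathcal{T}$ of functions on $[0,d]$ closed under addition has Pareto dimension $k$ if there is a map $p:\mathcal{T}\to\mathbb{Q}^k$ (a Pareto representation) such that $\tau_1\le\tau_2$ iff $p(\tau_1)\le p(\tau_2)$ componentwise, and $p(\tau_1+\tau_2)=p(\tau_1)+p(\tau_2)$. ''Cost functions with Pareto dimension $k$ whose derivatives have Pareto dimension $\ell$'' means all $\tau_e$ lie in such a class $\mathcal{T}$ with representation $p$, and the derivatives of functions in $\mathcal{T}$ form a class of Pareto dimension $\ell$ with representation $p'$. Multi-criteria shortest path problem with $m$ criteria: given edge weights $w(e)\in\mathbb{Q}^m$ and path weight $w(P)=\sum_{e\in P}w(e)$, compute all $s$–$t$ paths $P$ such that no other $s$–$t$ path $P'$ has $w(P')\le w(P)$ componentwise with $w(P')\neq w(P)$. Scoring a set of alternatives means computing $\mathcal{C}_P$ for each and choosing the best. *)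

(* Defs.v *)
From mathcomp Require Import all_boot all_order all_algebra.
From mathcomp Require Import boolp classical_sets functions topology normedtype.

Set Implicit Arguments.
Unset Strict Implicit.
Unset Printing Implicit Defensive.

Import Order.TTheory GRing.Theory Num.Theory.
Import numFieldNormedType.Exports.

Local Open Scope classical_set_scope.
Local Open Scope ring_scope.

(* Parallel edges and loops are allowed: an ordinary digraph is the case in
   which e |-> (source e, target e) is injective. *)
Record digraph := Digraph {
  vertex : finType;
  edge : finType;
  source : edge -> vertex;
  target : edge -> vertex
}.

(* P is the edge set of a simple s-t path.  The sequence es lists its edges
   in order, so s :: map target es is the sequence of visited vertices; each
   edge leaves the vertex reached just before it, whence the condition that
   the sources are that sequence without its last item. *)
Definition simple_path (G : digraph) (s t : vertex G) (P : {set edge G}) : Prop :=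
  exists es : seq (edge G),
    [/\ map (@source G) es = belast s (map (@target G) es),
        last s (map (@target G) es) = t,
        uniq (s :: map (@target G) es)
      & P = [set e in es]%SET].

(* A function on [0, d] is represented by a total function rat -> rat whose
   values outside [0, d] are irrelevant; a function on the nonnegative
   rationals likewise. *)
Definition nonneg_rat : set rat := [set x | 0 <= x].
Definition segment (d : rat) : set rat := [set x | 0 <= x <= d].

Definition fun_le (d : rat) (f g : rat -> rat) : Prop :=
  forall x, segment d x -> f x <= g x.

(* The library derivative is two-sided, hence cannot be used at the ends of
   the domain: the limit is taken here within the domain D, in the usual
   topology of the ordered field rat. *)
Definition diff_quot (f : rat -> rat) (x y : rat) : rat^o := (f y - f x) / (y - x).

Definition derivable_in (D : set rat) (f : rat -> rat) (x : rat) : Prop :=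
  cvg (diff_quot f x @ within D (x : rat^o)^').

Definition deriv_in (D : set rat) (f : rat -> rat) (x : rat) : rat :=
  lim (diff_quot f x @ within D (x : rat^o)^').

Definition cost_function (f : rat -> rat) : Prop :=
  [/\ forall x, nonneg_rat x -> 0 < f x,
      forall x y, nonneg_rat x -> nonneg_rat y -> x <= y -> f x <= f y
    & forall x, nonneg_rat x -> derivable_in nonneg_rat f x].

Definition set_cost (E : finType) (tau : E -> rat -> rat) (A : {set E}) : rat -> rat :=
  fun x => \sum_(e in A) tau e x.

Definition flow_cost (E : finType) (d : rat) (tau : E -> rat -> rat)
    (Q P : {set E}) (x : rat) : rat :=
  x * set_cost tau (P :\: Q) x + (d - x) * set_cost tau (Q :\: P) (d - x)
    + d * set_cost tau (P :&: Q) d.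

(* A psychological model is the map xP assigning x_P to P. *)
Definition psychological_model (G : digraph) (s t : vertex G) (d : rat)
    (xP : {set edge G} -> rat) : Prop :=
  forall P, simple_path s t P -> segment d (xP P).

Definition score (E : finType) (d : rat) (tau : E -> rat -> rat) (Q : {set E})
    (xP : {set E} -> rat) (P : {set E}) : rat :=
  flow_cost d tau Q P (xP P).

Definition dominates (E : finType) (d : rat) (tau : E -> rat -> rat)
    (Q P1 P2 : {set E}) : Prop :=
  fun_le d (set_cost tau P1) (set_cost tau P2) /\
  fun_le d (deriv_in (segment d) (set_cost tau (P1 :&: Q)))
           (deriv_in (segment d) (set_cost tau (P2 :&: Q))).

Definition pareto_conform (G : digraph) (s t : vertex G) (d : rat)
    (tau : edge G -> rat -> rat) (Q : {set edge G}) (xP : {set edge G} -> rat) : Prop :=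
  forall P1 P2, simple_path s t P1 -> simple_path s t P2 ->
    dominates d tau Q P1 P2 -> score d tau Q xP P1 <= score d tau Q xP P2.

Definition no_mutual_dominance (G : digraph) (s t : vertex G) (d : rat)
    (tau : edge G -> rat -> rat) (Q : {set edge G}) : Prop :=
  forall P1 P2, simple_path s t P1 -> simple_path s t P2 ->
    dominates d tau Q P1 P2 -> dominates d tau Q P2 P1 -> P1 = P2.

Definition vec_le (m : nat) (u v : 'rV[rat]_m) : Prop :=
  forall i, u ord0 i <= v ord0 i.

(* p is only constrained on T; the equivalence forces it to agree on members
   of T that coincide on [0, d]. *)
Definition pareto_representation (d : rat) (T : set (rat -> rat)) (k : nat)
    (p : (rat -> rat) -> 'rV[rat]_k) : Prop :=
  (forall f g, T f -> T g -> (fun_le d f g <-> vec_le (p f) (p g))) /\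
  (forall f g, T f -> T g -> p (fun x => f x + g x) = p f + p g).

Definition pareto_dimension (d : rat) (T : set (rat -> rat)) (k : nat) : Prop :=
  (forall f g, T f -> T g -> T (fun x => f x + g x)) /\
  exists p : (rat -> rat) -> 'rV[rat]_k, pareto_representation d T p.

(* The derivatives on [0, d] of the members of T, again with arbitrary values
   outside [0, d]. *)
Definition derivatives (d : rat) (T : set (rat -> rat)) : set (rat -> rat) :=
  [set g | exists2 f, T f & forall x, segment d x ->
     derivable_in (segment d) f x /\ g x = deriv_in (segment d) f x].

Definition path_weight (E : finType) (m : nat) (w : E -> 'rV[rat]_m)
    (P : {set E}) : 'rV[rat]_m :=
  \sum_(e in P) w e.

(* The solution of the multi-criteria shortest path problem. *)
Definition mcsp_solution (G : digraph) (s t : vertex G) (m : nat)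
    (w : edge G -> 'rV[rat]_m) : set {set edge G} :=
  [set P | simple_path s t P /\
     forall P', simple_path s t P' ->
       ~ (vec_le (path_weight w P') (path_weight w P) /\
          path_weight w P' <> path_weight w P)].

Definition best_scored (E : finType) (d : rat) (tau : E -> rat -> rat)
    (Q : {set E}) (xP : {set E} -> rat) (S : set {set E}) (P : {set E}) : Prop :=
  S P /\ forall P', S P' -> score d tau Q xP P <= score d tau Q xP P'.

Definition sap_optimal (G : digraph) (s t : vertex G) (d : rat)
    (tau : edge G -> rat -> rat) (Q : {set edge G})
    (xP : {set edge G} -> rat) (P : {set edge G}) : Prop :=
  best_scored d tau Q xP (simple_path s t) P.

(* Main.v *)
(** Give the edge [e] the weight [(p tau_e, p' tau'_e)] if [e] lies on [Q] and
    [(p tau_e, 0)] otherwise.  Additivity of [p], [p'] and of the derivative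
    turns comparison of path weights into dominance.  Below an optimal
    alternative, in the order of weights, a path whose weight has least
    coordinate sum is not Pareto dominated, and by conformity its score is not
    larger. *)
Require Import Defs.
From mathcomp Require Import all_boot all_order all_algebra.
From mathcomp Require Import boolp classical_sets functions topology normedtype.

Set Implicit Arguments.
Unset Strict Implicit.
Unset Printing Implicit Defensive.

Import Order.TTheory GRing.Theory Num.Theory.
Import numFieldNormedType.Exports.

Local Open Scope classical_set_scope.
Local Open Scope ring_scope.

(** Properness makes limits within [segment d] unique; for [d = 0] the punctured segment would be
    empty. *)
Lemma within_dnbhs_segment_proper (d x : rat) : 0 < d -> segment d x ->
  ProperFilter (within (segment d) (x : rat^o)^').
Proof.
move=> d_gt0 /andP[x_ge0 x_le_d]; apply: Build_ProperFilter_ex => A.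
rewrite /within /= /dnbhs /within /= => /nbhs_ballP[e /= e_gt0 xeA].
(* A step of length at most [d / 2], taken away from the nearer end, cannot leave the segment. *)
pose h := Num.min (e / 2) (d / 2).
have h_gt0 : 0 < h by rewrite lt_min !divr_gt0.
have h_lt_e : h < e.
  by rewrite gt_min ltr_pdivrMr// ltr_pMr// ltr1n.
have h_le_d2 : h <= d / 2 by rewrite ge_min lexx orbT.
have [x_le|x_gt] := leP x (d / 2).
- exists (x + h); apply: xeA.
  + by rewrite /ball /= opprD addNKr normrN gtr0_norm.
  + by rewrite -subr_eq0 addrC addKr gt_eqF.
  + have := lerD x_le h_le_d2; rewrite -splitr => xh_le_d.
    by rewrite /segment /= xh_le_d addr_ge0// ltW.
- exists (x - h); apply: xeA.
  + by rewrite /ball /= opprB addrC subrK gtr0_norm.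
  + by rewrite -subr_eq0 addrC addKr oppr_eq0 gt_eqF.
  + rewrite /segment /= subr_ge0 (le_trans h_le_d2 (ltW x_gt))/=.
    by rewrite lerBlDr (le_trans x_le_d)// lerDl ltW.
Qed.

(** Costs are differentiable on the nonnegative rationals, whereas dominance takes derivatives
    within [[0, d]], one-sided at [d]. *)
Lemma derivable_in_subset (D D' : set rat) (f : rat -> rat) (x : rat) :
  D' `<=` D -> derivable_in D f x -> derivable_in D' f x.
Proof.
move=> D'D fD; apply: (cvgP _ (cvg_trans _ fD)).
by apply: cvg_app; exact: (@within_subset rat^o).
Qed.

Lemma deriv_in_set_cost (E : finType) (d : rat) (tau : E -> rat -> rat)
    (A : {set E}) (x : rat) : 0 < d -> segment d x ->
    (forall e, derivable_in (segment d) (tau e) x) ->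
  deriv_in (segment d) (set_cost tau A) x =
  \sum_(e in A) deriv_in (segment d) (tau e) x.
Proof.
move=> d_gt0 xd tau'; have FF := within_dnbhs_segment_proper d_gt0 xd.
apply: (@cvg_lim rat^o); first exact: norm_hausdorff.
have -> : diff_quot (set_cost tau A) x =
    (fun y => \sum_(e in A) diff_quot (tau e) x y).
  by apply/funext => y; rewrite /diff_quot -sumrB mulr_suml.
by apply: cvg_big => [|e _]; [exact: add_continuous | exact: tau'].
Qed.

Section ParetoRepresentation.
Variables (d : rat) (T : set (rat -> rat)) (k : nat).
Variable p : (rat -> rat) -> 'rV[rat]_k.
Hypothesis T_add : forall f g, T f -> T g -> T (fun x => f x + g x).
Hypothesis p_rep : pareto_representation d T p.
Variables (E : finType) (F : E -> rat -> rat).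
Hypothesis T_F : forall e, T (F e).

(** Induction along the enumeration of [E]; the base case is [h] itself. *)
Lemma pareto_representation_sum (A : {set E}) (h : rat -> rat) : T h ->
  T (fun x => \sum_(e in A) F e x + h x) /\
  p (fun x => \sum_(e in A) F e x + h x) = \sum_(e in A) p (F e) + p h.
Proof.
move=> Th; have [_ pD] := p_rep.
elim: (index_enum E) => [|e r [Tr pr]].
  have -> : (fun x => \sum_(e <- [::] | e \in A) F e x + h x) = h.
    by apply/funext => x; rewrite big_nil add0r.
  by rewrite big_nil add0r.
rewrite big_cons; case: ifP => eA; last first.
  by under eq_fun do rewrite big_cons eA.
under eq_fun do rewrite big_cons eA -addrA.
by split; [exact: T_add | rewrite pD// pr addrA].
Qed.

(* T need not contain 0, so a member of T is added to both sides to make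
   empty sums comparable as well. *)
Lemma pareto_representation_sum_le (A B : {set E}) :
  fun_le d (fun x => \sum_(e in A) F e x) (fun x => \sum_(e in B) F e x) <->
  vec_le (\sum_(e in A) p (F e)) (\sum_(e in B) p (F e)).
Proof.
(* [F e0] is the member of [T] to be added. If [E] is empty, then so are [A] and [B], and both sides
   hold by reflexivity. *)
have [e0 _|E0] := pickP (@predT E); last first.
  have -> : A = B by apply/setP => e; have := E0 e.
  by split=> _ ?.
have [TA pA] := pareto_representation_sum A (T_F e0).
have [TB pB] := pareto_representation_sum B (T_F e0).
have [/(_ _ _ TA TB)] := p_rep; rewrite pA pB => -[le1 le2] _.
split=> [leF i|lep x xd].
- have := le1 _ i; rewrite !mxE lerD2r; apply=> x xd.
  by rewrite lerD2r leF.
- have := le2 _ x xd; rewrite lerD2r; apply=> i.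
  by rewrite !mxE lerD2r.
Qed.

End ParetoRepresentation.

Lemma vec_le_row_mx (k l : nat) (u1 v1 : 'rV[rat]_k) (u2 v2 : 'rV[rat]_l) :
  vec_le (row_mx u1 u2) (row_mx v1 v2) <-> vec_le u1 v1 /\ vec_le u2 v2.
Proof.
split=> [le_uv|[le1 le2] i].
- split=> i; first by have := le_uv (lshift l i); rewrite !row_mxEl.
  by have := le_uv (rshift k i); rewrite !row_mxEr.
- by case: (split_ordP i) => j ->; rewrite ?row_mxEl ?row_mxEr.
Qed.

Lemma vec_le_trans (m : nat) (v u w : 'rV[rat]_m) :
  vec_le u v -> vec_le v w -> vec_le u w.
Proof. by move=> uv vw i; exact: le_trans (uv i) (vw i). Qed.

(** One strict coordinate would make the sum of [u] strictly smaller. *)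
Lemma vec_le_sum_eq (m : nat) (u v : 'rV[rat]_m) :
  vec_le u v -> \sum_i v ord0 i <= \sum_i u ord0 i -> u = v.
Proof.
move=> uv vu; apply/rowP => i; apply/eqP; rewrite eq_le uv /=.
rewrite leNgt; apply/negP => uvi; move: vu; apply/negP; rewrite -ltNge.
by rewrite (bigD1 i)//= [ltRHS](bigD1 i)//= ltr_leD// ler_sum.
Qed.

Lemma exists_min_simple_path (G : digraph) (s t : vertex G)
    (R : {set edge G} -> Prop) (f : {set edge G} -> rat) (P0 : {set edge G}) :
  simple_path s t P0 -> R P0 ->
  exists P, [/\ simple_path s t P, R P &
    forall P', simple_path s t P' -> R P' -> f P <= f P'].
Proof.
move=> P0_path RP0.
have P0_sat : `[< simple_path s t P0 /\ R P0 >] by apply/asboolP.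
case: (@arg_minP _ _ _ P0 (fun P => `[< simple_path s t P /\ R P >]) f P0_sat).
move=> P /asboolP[P_path RP] minP.
by exists P; split=> // P' P'_path RP'; apply: minP; apply/asboolP.
Qed.

(** A path weighing at most as much as the chosen [P] is also below [P0], so its coordinate sum is
    no smaller and the weights agree. *)
Lemma mcsp_solution_below (G : digraph) (s t : vertex G) (m : nat)
    (w : edge G -> 'rV[rat]_m) (P0 : {set edge G}) : simple_path s t P0 ->
  exists2 P, mcsp_solution s t w P & vec_le (path_weight w P) (path_weight w P0).
Proof.
move=> P0_path.
have [|P [P_path PP0 minP]] := @exists_min_simple_path G s t
  (fun P => vec_le (path_weight w P) (path_weight w P0))
  (fun P => \sum_i path_weight w P ord0 i) P0 P0_path; first by move=> i.
exists P => //; split=> // P' P'_path [P'P]; apply.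
by apply: vec_le_sum_eq => //; apply: minP => //; exact: vec_le_trans PP0.
Qed.

(* The weights must reproduce the dominance relation on alternatives: without
   the first conjunct the constant weight 0, for which no path is dominated,
   would do. *)
Theorem theorem3 (G : digraph) (s t : vertex G) (d : rat)
    (tau : edge G -> rat -> rat) (Q : {set edge G})
    (xP : {set edge G} -> rat)
    (k l : nat) (T : set (rat -> rat))
    (d_gt0 : (0 < d)%R)
    (tau_cost : forall e, cost_function (tau e))
    (Q_path : simple_path s t Q)
    (tau_antisym : no_mutual_dominance s t d tau Q)
    (xP_model : psychological_model s t d xP)
    (xP_conform : pareto_conform s t d tau Q xP)
    (tau_T : forall e, T (tau e))
    (T_dim : pareto_dimension d T k)
    (T'_dim : pareto_dimension d (derivatives d T) l) :
  exists w : edge G -> 'rV[rat]_(k + l),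
    [/\ forall P1 P2, simple_path s t P1 -> simple_path s t P2 ->
          (vec_le (path_weight w P1) (path_weight w P2) <->
           dominates d tau Q P1 P2),
        exists2 P, mcsp_solution s t w P & sap_optimal s t d tau Q xP P
      & forall P, best_scored d tau Q xP (mcsp_solution s t w) P ->
          sap_optimal s t d tau Q xP P].
Proof.
have [T_add [p p_rep]] := T_dim.
have [T'_add [p' p'_rep]] := T'_dim.
pose tau' e := deriv_in (segment d) (tau e).
have tau_der e x : segment d x -> derivable_in (segment d) (tau e) x.
  move=> /andP[x_ge0 _]; have [_ _ /(_ x x_ge0)] := tau_cost e.
  by apply: derivable_in_subset => y /andP[].
have T'_tau' e : derivatives d T (tau' e).
  by exists (tau e) => // x xd; split=> //; exact: tau_der.
pose w e : 'rV[rat]_(k + l) :=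
  row_mx (p (tau e)) (if e \in Q then p' (tau' e) else 0).
have wE P : path_weight w P =
    row_mx (\sum_(e in P) p (tau e)) (\sum_(e in P :&: Q) p' (tau' e)).
  (* The zero weight off [Q] turns the sum over [P] into one over [P :&: Q]. *)
  rewrite [X in row_mx _ X](eq_bigl _ _ (fun e => finset.in_setI e P Q)).
  rewrite [X in row_mx _ X]big_mkcondr; apply/rowP => i; rewrite summxE.
  by case: (split_ordP i) => j ->; rewrite ?row_mxEl ?row_mxEr summxE;
    apply: eq_bigr => e _; rewrite ?row_mxEl ?row_mxEr.
have w_dom P1 P2 : vec_le (path_weight w P1) (path_weight w P2) <->
    dominates d tau Q P1 P2.
  rewrite !wE; apply: iff_trans (vec_le_row_mx _ _ _ _) _.
  have le1 := pareto_representation_sum_le T_add p_rep tau_T P1 P2.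
  have le2 := pareto_representation_sum_le T'_add p'_rep T'_tau'
    (P1 :&: Q)%SET (P2 :&: Q)%SET.
  (* Differentiation commutes with the finite sum at every point of [[0, d]], which is all that
     [fun_le] inspects. *)
  have tau'E : fun_le d (deriv_in (segment d) (set_cost tau (P1 :&: Q)))
      (deriv_in (segment d) (set_cost tau (P2 :&: Q))) <->
      fun_le d (fun x => \sum_(e in P1 :&: Q) tau' e x)
        (fun x => \sum_(e in P2 :&: Q) tau' e x).
    split=> le12 x xd; have := le12 x xd;
      by rewrite !deriv_in_set_cost// => e; exact: tau_der.
  split=> [[/le1 dom1 /le2 dom2]|[dom1 /tau'E dom2]].
  - by split=> //; apply/tau'E.
  - by split; [exact/le1 | exact/le2].
(* [Q] witnesses that alternatives exist; being finitely many, they include an optimal one. *)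
have [Popt [Popt_path _ Popt_min]] := @exists_min_simple_path G s t
  (fun=> True) (score d tau Q xP) Q Q_path I.
have [P [P_path P_nd] PPopt] := mcsp_solution_below w Popt_path.
have P_opt : sap_optimal s t d tau Q xP P.
  split=> // P' P'_path; apply: le_trans (Popt_min P' P'_path I).
  by apply: xP_conform => //; exact/w_dom.
exists w; split=> //; first by exists P.
(* The optimal [P] is itself among the solutions, so [P1] scores no worse than it. *)
move=> P1 [[P1_path _] P1_min]; split=> // P' P'_path.
by apply: le_trans (P1_min P _) _ => //; case: P_opt => _; apply.
Qed.
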